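(* Run on an instance with $\lambda^*\in[1,\sigma m]$, the constant-factor approximation algorithm (described in the context) computes a solution $x^{(T)}\in\mathcal{X}$ with $\|x^{(T)}\|_\infty\le16\sigma\lambda^*$ and uses $\mathcal{O}((n+m)\log m)$ oracle calls.
   Context: Resource sharing problem: finite sets $\mathcal{C}$ (customers) and $\mathcal{R}$ (resources), $n=|\mathcal{C}|$, $m=|\mathcal{R}|$; for each $C$ a nonempty closed convex $X_C\subseteq\mathbb{R}^{\mathcal{R}}_{\ge0}$; $\mathcal{X}=\sum_CX_C$ (Minkowski sum); a constant $\sigma\ge1$ (treated as a constant in $\mathcal{O}$-notation) and oracles $f_C:\mathbb{R}^m_{\ge0}\to X_C$ with $\langle y,f_C(y)\rangle\le\sigma\min_{x\in X_C}\langle y,x\rangle$, an evaluation of some $f_C$ being an oracle call; $\lambda^*=\min_{x\in\mathcal{X}}\|x\|_\infty$; $\log$ is the natural logarithm. Constant-factor approximation algorithm: initialize $y=\mathbb{1}\in\mathbb{R}^m$, $\epsilon=\frac1{4\sigma}$, $\Lambda=1$, $T=\lceil\log m\rceil$. For phases $t=1,\dots,T$: store $y^{(t-1)}\gets y$; then (phase body) for each customer $C$ (in a fixed order) set $\alpha=0$, $s^{(t)}_C=0$ and, while $\alpha<1$: $b\gets f_C(y)$; $\xi\gets\min\{1-\alpha,\Lambda/\|b\|_\infty\}$; $y_r\gets y_r\exp(\epsilon\xi b_r)$ for all $r$; $s^{(t)}_C\gets s^{(t)}_C+\xi b$; $\alpha\gets\alpha+\xi$; if $\|y\|_1>m\,e^{t}$,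 then (a restart) set $y\gets y^{(t-1)}$, $\epsilon\gets\epsilon/2$, $\Lambda\gets2\Lambda$, discard all solutions of phase $t$ and restart the phase body of phase $t$ from the first customer. After all customers of phase $t$ are processed, $s^{(t)}=\sum_Cs^{(t)}_C$. Return $x^{(T)}=\frac1T\sum_{t=1}^Ts^{(t)}$.
   Formalization: The formal theorem assumes m ≥ 2: for m = 1 the algorithm has T = ⌈log 1⌉ = 0 phases, so the returned x^(T) = (1/T)·(empty sum) is undefined. *)

(* Defs.v *)
From HB Require Import structures.
From mathcomp Require Import all_boot all_order all_algebra.
From mathcomp Require Import all_classical all_reals all_analysis.

Set Implicit Arguments.
Unset Strict Implicit.
Unset Printing Implicit Defensive.

Import Order.TTheory GRing.Theory Num.Theory.
Import numFieldNormedType.Exports.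

Local Open Scope classical_set_scope.
Local Open Scope ring_scope.

(* Customers are 'I_n and resources are 'I_m.  On 'rV[R]_m the library norm
   `|x| is the maximum of the absolute values of the entries, i.e. the
   l-infinity norm, and [closed] refers to the topology of that norm. *)

Definition dotp (R : realType) (m : nat) (y x : 'rV[R]_m) : R :=
  \sum_(r < m) y 0 r * x 0 r.

Definition norm1 (R : realType) (m : nat) (y : 'rV[R]_m) : R :=
  \sum_(r < m) `|y 0 r|.

Definition nonneg_orthant (R : realType) (m : nat) : set 'rV[R]_m :=
  [set x | forall r, 0 <= x 0 r].

Definition minkowski_sum (R : realType) (n m : nat)
    (X : 'I_n -> set 'rV[R]_m) : set 'rV[R]_m :=
  [set x | exists2 x_ : 'I_n -> 'rV[R]_m,
             forall C, X C (x_ C) & x = \sum_(C < n) x_ C].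

(* The sets below are nonempty and bounded below by 0 in every use, so [inf]
   is their genuine infimum, and it is their minimum whenever that exists.  In
   [lambda_star] it always does: a Minkowski sum of closed subsets of the
   nonnegative orthant is closed. *)
Definition lambda_star (R : realType) (n m : nat)
    (X : 'I_n -> set 'rV[R]_m) : R :=
  inf [set `|x| | x in minkowski_sum X].

(* The value of f outside the nonnegative orthant is irrelevant. *)
Definition is_oracle (R : realType) (m : nat) (sigma : R)
    (X : set 'rV[R]_m) (f : 'rV[R]_m -> 'rV[R]_m) : Prop :=
  forall y, nonneg_orthant y ->
    X (f y) /\ dotp y (f y) <= sigma * inf [set dotp y x | x in X].

(* A state is taken at the head of the loops of the algorithm.  [todo] lists,
   in the fixed order 0, ..., n-1, the customers not yet finished in phase
   [phase]; its head is the customer being processed.  [weight] is y, [stored]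
   is y^(t-1) for t = [phase], [sol t C] is s^(t)_C (zero as long as customer C
   has not been treated in phase t), and [calls] counts oracle calls, including
   those of discarded runs of a phase body. *)
Record state (R : realType) (n m : nat) : Type := State {
  phase : nat;
  todo : seq 'I_n;
  alpha : R;
  weight : 'rV[R]_m;
  stored : 'rV[R]_m;
  epsilon : R;
  Lambda : R;
  sol : nat -> 'I_n -> 'rV[R]_m;
  calls : nat
}.

(* T = ceil (log m); the absolute value only converts int to nat, as
   log m >= 0 for m > 0. *)
Definition nphases (R : realType) (m : nat) : nat :=
  `|Num.ceil (ln (m%:R : R))|%N.

Definition init_state (R : realType) (n m : nat) (sigma : R) : state R n m :=
  {| phase := 1;
     todo := enum 'I_n;
     alpha := 0;
     weight := const_mx 1;
     stored := const_mx 1;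
     epsilon := (4 * sigma)^-1;
     Lambda := 1;
     sol := fun _ _ => 0;
     calls := 0 |}.

(* min {1 - alpha, Lambda / |b|}, where Lambda / 0 is +oo. *)
Definition step_size (R : realType) (m : nat) (alpha Lambda : R)
    (b : 'rV[R]_m) : R :=
  if b == 0 then 1 - alpha else Num.min (1 - alpha) (Lambda / `|b|).

Definition restart (R : realType) (n m : nat) (st : state R n m) :
    state R n m :=
  {| phase := phase st;
     todo := enum 'I_n;
     alpha := 0;
     weight := stored st;
     stored := stored st;
     epsilon := epsilon st / 2;
     Lambda := 2 * Lambda st;
     sol := fun t C => if t == phase st then 0 else sol st t C;
     calls := calls st |}.

(* One iteration of the while loop for customer C: exactly one oracle call. *)
Definition while_body (R : realType) (n m : nat)
    (f : 'I_n -> 'rV[R]_m -> 'rV[R]_m) (C : 'I_n) (st : state R n m) :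
    state R n m :=
  let b := f C (weight st) in
  let xi := step_size (alpha st) (Lambda st) b in
  let st' :=
    {| phase := phase st;
       todo := todo st;
       alpha := alpha st + xi;
       weight := \row_r (weight st 0 r * expR (epsilon st * xi * b 0 r));
       stored := stored st;
       epsilon := epsilon st;
       Lambda := Lambda st;
       sol := fun t D => if (t == phase st) && (D == C)
                         then sol st t D + xi *: b else sol st t D;
       calls := (calls st).+1 |} in
  if m%:R * expR (phase st)%:R < norm1 (weight st') then restart st' else st'.

Definition next_customer (R : realType) (n m : nat) (st : state R n m) :
    state R n m :=
  {| phase := phase st;
     todo := behead (todo st);
     alpha := 0;
     weight := weight st;
     stored := stored st;
     epsilon := epsilon st;
     Lambda := Lambda st;
     sol := sol st;
     calls := calls st |}.

Definition next_phase (R : realType) (n m : nat) (st : state R n m) :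
    state R n m :=
  {| phase := (phase st).+1;
     todo := enum 'I_n;
     alpha := 0;
     weight := weight st;
     stored := weight st;
     epsilon := epsilon st;
     Lambda := Lambda st;
     sol := sol st;
     calls := calls st |}.

Definition halted (R : realType) (n m : nat) (st : state R n m) : bool :=
  (nphases R m < phase st)%N.

Definition step (R : realType) (n m : nat)
    (f : 'I_n -> 'rV[R]_m -> 'rV[R]_m) (st : state R n m) : state R n m :=
  if halted st then st
  else if todo st is C :: _ then
    if alpha st < 1 then while_body f C st else next_customer st
  else next_phase st.

(* The state after k steps; halted states are fixed points of [step]. *)
Definition run (R : realType) (n m : nat) (sigma : R)
    (f : 'I_n -> 'rV[R]_m -> 'rV[R]_m) (k : nat) : state R n m :=
  iter k (step f) (init_state n m sigma).

Definition output (R : realType) (n m : nat) (st : state R n m) : 'rV[R]_m :=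
  (nphases R m)%:R^-1 *:
    \sum_(1 <= t < (nphases R m).+1) \sum_(C < n) sol st t C.

(* Main.v *)
Require Import Defs.
From HB Require Import structures.
From mathcomp Require Import all_boot all_order all_algebra.
From mathcomp Require Import all_classical all_reals all_analysis.
From mathcomp Require Import ring lra zify.

Set Implicit Arguments.
Unset Strict Implicit.
Unset Printing Implicit Defensive.

Import Order.TTheory GRing.Theory Num.Theory.
Import numFieldNormedType.Exports.

Local Open Scope classical_set_scope.
Local Open Scope ring_scope.


(** For [Lambda >= lambda_star X] no restart happens: with a point of nearly
    optimal norm as comparison, the oracle guarantee bounds the growth of
    [norm1 y] within a phase by a factor 2, so [Lambda <= 2 * lambda_star X]
    throughout.  As [y r >= expR (epsilon * load r)] and
    [norm1 y <= m * expR t], the average of the first [t] phases has norm at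
    most [(ln m + t) / (epsilon * t)]; at [t = T] this is [8 * sigma * Lambda].

    An oracle call either finishes a customer or raises [\sum_r ln (y r)] by at
    least [(4 * sigma)^-1], while concavity of [ln] gives
    [\sum_r ln (y r) <= m * t].  A discarded run in phase [t] thus costs
    [n + 1 + 4 * sigma * m * t] calls, and summing this crudely over the
    [O(ln m)] restarts would give [m * (ln m)^2].  But the same average bound
    applied to the [t - 1] completed phases gives
    [(t - 1) * lambda_star X <= 8 * sigma * Lambda * T] at a restart, and
    since [Lambda] doubles these costs sum up geometrically to
    [O(m * ln m)]. *)

(** * Norms, pairings, convex sets and elementary inequalities *)

Section General.
Variables (R : realType) (n m : nat).
Implicit Types (x y b : 'rV[R]_m) (X : 'I_n -> set 'rV[R]_m).

Lemma row_le_norm x r : `|x 0 r| <= `|x|.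
Proof.
rewrite [leRHS]mx_normrE.
exact: (le_bigmax _ (fun ij : 'I_1 * 'I_m => `|x ij.1 ij.2|) (0, r)).
Qed.

Lemma row_norm_le x (B : R) : 0 <= B -> (forall r, `|x 0 r| <= B) -> `|x| <= B.
Proof.
move=> B0 xB; rewrite [leLHS]mx_normrE; apply: bigmax_le => // -[i r] _ /=.
by rewrite (ord1 i).
Qed.

Lemma norm_le_norm1 x : `|x| <= norm1 x.
Proof.
apply: row_norm_le => [|r]; first exact: sumr_ge0.
by rewrite /norm1 (bigD1 r)//= lerDl sumr_ge0.
Qed.

Lemma dotp_sumr y (x_ : 'I_n -> 'rV[R]_m) :
  dotp y (\sum_C x_ C) = \sum_C dotp y (x_ C).
Proof.
rewrite /dotp exchange_big; apply: eq_bigr => r _ /=.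
by rewrite summxE mulr_sumr.
Qed.

Lemma dotp_ge0 y x : nonneg_orthant y -> nonneg_orthant x -> 0 <= dotp y x.
Proof. by move=> y0 x0; apply: sumr_ge0 => r _; apply: mulr_ge0. Qed.

Lemma ler_dotpl x y y' : nonneg_orthant x -> (forall r, y 0 r <= y' 0 r) ->
  dotp y x <= dotp y' x.
Proof. by move=> x0 yy'; apply: ler_sum => r _; apply: ler_wpM2r. Qed.

Lemma dotp_le_norm y x : dotp y x <= norm1 y * `|x|.
Proof.
rewrite /dotp /norm1 mulr_suml; apply: ler_sum => r _.
by rewrite (le_trans (ler_norm _))// normrM ler_wpM2l// row_le_norm.
Qed.

Lemma norm1_ge0E y : nonneg_orthant y -> norm1 y = \sum_r y 0 r.
Proof. by move=> y0; apply: eq_bigr => r _; rewrite ger0_norm. Qed.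

Lemma convex_set_conv (A : set 'rV[R]_m) x y (a : R) : convex_set A ->
  0 <= a <= 1 -> A x -> A y -> A (a *: x + (1 - a) *: y).
Proof.
move=> cA a01 Ax Ay.
have /set_mem := cA x y (Itv01 (proj1 (andP a01)) (proj2 (andP a01)))
  (mem_set Ax) (mem_set Ay).
by [].
Qed.

(** Cone form of convexity, suited to unnormalised partial solutions: normalise by [a + b], which is
    nonzero because [b] is positive. The coefficient [a] may be zero, as when nothing has been
    accumulated yet. *)
Lemma convex_set_cone (A : set 'rV[R]_m) x y (a b : R) : convex_set A ->
  0 <= a -> 0 < b -> A x -> A y ->
  exists2 z, A z & a *: x + b *: y = (a + b) *: z.
Proof.
move=> cA a0 b0 Ax Ay; have ab0 : 0 < a + b by lra.
exists ((a / (a + b)) *: x + (1 - a / (a + b)) *: y).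
  apply: convex_set_conv => //; rewrite (divr_ge0 a0 (ltW ab0))/=.
  by rewrite ler_pdivrMr// mul1r lerDl ltW.
rewrite scalerDr !scalerA; congr (_ *: _ + _ *: _); field; exact: lt0r_neq0.
Qed.

Lemma convex_set_sum (A : set 'rV[R]_m) (s : nat -> 'rV[R]_m) (T : nat) :
  convex_set A -> A !=set0 -> (forall t, (0 < t <= T)%N -> A (s t)) ->
  exists2 z, A z & \sum_(1 <= t < T.+1) s t = T%:R *: z.
Proof.
move=> cA [x0 Ax0]; elim: T => [|T IH] As.
  by exists x0 => //; rewrite big_geq// scale0r.
have [|z Az sz] := IH.
  by move=> t /andP[t0 tT]; apply: As; rewrite t0 leqW.
have sT : A (s T.+1) by apply: As; rewrite ltnS leqnn.
have [z' Az' e] := convex_set_cone cA (ler0n _ T) ltr01 Az sT.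
by exists z' => //; rewrite big_nat_recr//= sz -[in RHS]natr1 -e scale1r.
Qed.

Lemma lambda_star_le X x : minkowski_sum X x -> lambda_star X <= `|x|.
Proof.
by move=> Xx; apply: ge_inf; [exists 0 => _ [z _ <-] | exists x].
Qed.

(** Near-minimisers are enough for the growth estimate, which has room for a factor 3/2. *)
Lemma lambda_star_adherent X (c : R) : (forall C, X C !=set0) ->
  lambda_star X < c -> exists2 x, minkowski_sum X x & `|x| < c.
Proof.
move=> X0 Xc.
have [x_ Xx] := choice (X0 : forall C, exists x, X C x).
have [||_ [x ? <-] xc] := @inf_adherent _ [set `|x| | x in minkowski_sum X]
   (c - lambda_star X).
- by rewrite subr_gt0.
- split; first by exists `|\sum_C x_ C|, (\sum_C x_ C) => //; exists x_.
  by exists 0 => _ [z _ <-].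
- by exists x => //; rewrite -(subrK (lambda_star X) c) addrC.
Qed.

Lemma oracle_le (sigma : R) (A : set 'rV[R]_m) f y x : 0 <= sigma ->
  is_oracle sigma A f -> A `<=` @nonneg_orthant R m -> nonneg_orthant y ->
  A x -> dotp y (f y) <= sigma * dotp y x.
Proof.
move=> s0 fA A0 y0 Ax; have [_ /le_trans -> //] := fA _ y0.
rewrite ler_wpM2l//; apply: ge_inf; last by exists x.
by exists 0 => _ [z Az <-]; apply: dotp_ge0 => //; apply: A0.
Qed.

(* From [expR (- a) >= 1 - a]. *)
Lemma expR_le_quarter (a : R) : a <= 4^-1 -> 0 <= a -> expR a <= 1 + 4 / 3 * a.
Proof.
move=> a4 a0; have := expR_ge1Dx (- a); rewrite expRN => h.
have e0 := expR_gt0 a.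
have : (1 - a) * expR a <= 1.
  by rewrite -ler_pdivlMr// mul1r.
nra.
Qed.

Lemma ge1_expR (a : R) : 0 <= a -> 1 <= expR a.
Proof. by rewrite -[in 1 <= _](@expR0 R) ler_expR. Qed.

Lemma ln_le_subr1 (x : R) : 0 < x -> ln x <= x - 1.
Proof.
by move=> x0; have := expR_ge1Dx (ln x); rewrite lnK ?posrE//; lra.
Qed.

(* Concavity of [ln], through its tangent at [expR t]. *)
Lemma sum_ln_le y (t : R) : (forall r, 0 < y 0 r) ->
  norm1 y <= m%:R * expR t -> \sum_r ln (y 0 r) <= m%:R * t.
Proof.
move=> y0 yt.
have y1 : norm1 y = \sum_r y 0 r by apply: norm1_ge0E => r; exact: ltW.
have : \sum_r ln (y 0 r) <= \sum_r (expR (- t) * y 0 r + (t - 1)).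
  apply: ler_sum => r _; have := @ln_le_subr1 (expR (- t) * y 0 r).
  rewrite mulr_gt0 ?expR_gt0// lnM ?posrE ?expR_gt0// expRK => /(_ isT); lra.
move=> /le_trans; apply.
rewrite big_split/= -mulr_sumr -y1 sumr_const card_ord -[_ *+ m]mulr_natl.
have : expR (- t) * norm1 y <= m%:R.
  by rewrite expRN mulrC ler_pdivrMr ?expR_gt0.
lra.
Qed.

End General.

Section Algorithm.
Variables (R : realType) (sigma : R) (n m : nat).
Variables (X : 'I_n -> set 'rV[R]_m) (f : 'I_n -> 'rV[R]_m -> 'rV[R]_m).
Hypothesis sigma_ge1 : 1 <= sigma.
Hypothesis m_gt1 : (1 < m)%N.
Hypothesis X_neq0 : forall C, X C !=set0.
Hypothesis X_convex : forall C, convex_set (X C).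
Hypothesis X_ge0 : forall C, X C `<=` @nonneg_orthant R m.
Hypothesis f_oracle : forall C, is_oracle sigma (X C) (f C).
Hypothesis lambda_ge1 : 1 <= lambda_star X.

Local Notation lambda := (lambda_star X).
Local Notation T := (nphases R m).
Implicit Types (st : state R n m) (s : nat -> 'I_n -> 'rV[R]_m).

Let m_gt0 : 0 < (m%:R : R). Proof. by rewrite ltr0n ltnW. Qed.

(** * Number of phases, served fractions and step size *)

Lemma nphasesE : T%:R = (Num.ceil (ln (m%:R : R)))%:~R :> R.
Proof.
rewrite /nphases -[in RHS](gez0_abs (_ : 0 <= Num.ceil (ln m%:R)))//.
rewrite ceil_ge0 (lt_le_trans (ltrN10 _))// ln_ge0// ler1n.
exact: ltnW.
Qed.

Lemma ln_le_nphases : ln (m%:R : R) <= T%:R.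
Proof. by rewrite nphasesE ceil_ge. Qed.

Lemma nphases_lt : (T%:R : R) < ln (m%:R : R) + 1.
Proof.
by rewrite nphasesE -ltrBlDr; have := ceilB1_lt (ln (m%:R : R)); rewrite intrB.
Qed.

Lemma nphases_gt0 : (0 < T)%N.
Proof.
rewrite -(ltr0n R); apply: lt_le_trans ln_le_nphases.
by rewrite ln_gt0// ltr1n.
Qed.

(* The fraction of customer [C] served so far in the current phase. *)
Definition served (todo : seq 'I_n) (a : R) (C : 'I_n) : R :=
  if C \in todo then (if C == head C todo then a else 0) else 1.

Lemma served_ge0 l a C : 0 <= a -> 0 <= served l a C.
Proof. by rewrite /served; do 2?case: ifP. Qed.

Lemma served_le1 l a C : a <= 1 -> served l a C <= 1.
Proof. by rewrite /served; do 2?case: ifP. Qed.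

Lemma served_enum C : served (enum 'I_n) 0 C = 0.
Proof. by rewrite /served mem_enum; case: ifP. Qed.

Lemma served_nil a C : served [::] a C = 1.
Proof. by []. Qed.

Lemma served_head C l a xi D :
  served (C :: l) (a + xi) D = served (C :: l) a D + (D == C)%:R * xi.
Proof.
rewrite /served inE/=; case: eqP => //= _; first by rewrite mul1r.
by rewrite mul0r addr0.
Qed.

(** Moving on to the next customer leaves all fractions unchanged, so every clause of the invariant
    phrased with [served] carries over. *)
Lemma served_behead C l D : uniq (C :: l) -> served l 0 D = served (C :: l) 1 D.
Proof.
rewrite /served inE/= => /andP[Cl _].
have [->|_] := eqVneq D C; first by rewrite (negbTE Cl).
by case: ifP => // Dl; case: ifP.
Qed.

(** The final disjunction is the dichotomy behind the call count: a call completes the customer or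
    uses the full width [L]. For [b = 0] it is the former. *)
Lemma step_sizeP (a L : R) (b : 'rV[R]_m) : a < 1 -> 0 < L ->
  let xi := step_size a L b in
  [/\ 0 < xi, a + xi <= 1, xi * `|b| <= L & a + xi = 1 \/ xi * `|b| = L].
Proof.
move=> a1 L0; rewrite /step_size; case: eqP => [->|/eqP b0] /=.
  rewrite normr0 mulr0; split; [lra|lra|exact: ltW|by left; lra].
have nb : 0 < `|b| by rewrite normr_gt0.
have LbK : L / `|b| * `|b| = L by rewrite divfK ?gt_eqF.
have Lb : 0 < L / `|b| by rewrite divr_gt0.
rewrite /Num.min; case: ifPn => h; last first.
  by split; [| |rewrite LbK|right]; rewrite // -?leNgt in h *; lra.
split; [lra|lra| |left; lra].
by rewrite -[leRHS]LbK ler_wpM2r// ltW.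
Qed.

(* State after an oracle call for [C], before the test that decides on a
   restart. *)
Definition serve (C : 'I_n) st : state R n m :=
  let b := f C (weight st) in
  let xi := step_size (alpha st) (Lambda st) b in
  {| phase := phase st;
     todo := todo st;
     alpha := alpha st + xi;
     weight := \row_r (weight st 0 r * expR (epsilon st * xi * b 0 r));
     stored := stored st;
     epsilon := epsilon st;
     Lambda := Lambda st;
     sol := fun t D => if (t == phase st) && (D == C)
                       then sol st t D + xi *: b else sol st t D;
     calls := (calls st).+1 |}.

(** Negation of the restart test. It stays outside [invariant], since the state between an oracle
    call and the test may violate it. *)
Definition weight_bounded st : Prop :=
  norm1 (weight st) <= m%:R * expR (phase st)%:R.

(** Phase [k] itself is excluded: [k = phase st] gives the completed phases, and its successor adds
    the current one. *)
Definition load s (k : nat) (r : 'I_m) : R :=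
  \sum_(1 <= t < k) \sum_C s t C 0 r.

(* Calls spent in discarded runs of phase bodies: every restart costs at most
   [n + 1 + 4 sigma m t] calls, and the restart from [Lambda] happens in a phase
   [t <= 1 + 8 sigma T Lambda / lambda], so the phase-dependent parts sum up
   geometrically. *)
Definition discarded (L : R) : R :=
  ln L / ln 2 * (n%:R + 1 + 4 * sigma * m%:R) +
  32 * sigma ^+ 2 * m%:R * T%:R / lambda * (L - 1).

(** Loads are bounded against both [stored] and [weight], since a restart falls back on the former.
    [inv_growth] evaluates at the current weights, which dominate those at which the oracle was
    queried. In [inv_calls], everything after [discarded] pays for the calls that were kept. *)
Record invariant st : Prop := Invariant {
  inv_phase : (0 < phase st <= T.+1)%N;
  inv_uniq : uniq (todo st);
  inv_alpha : 0 <= alpha st <= 1;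
  inv_Lambda : 1 <= Lambda st <= 2 * lambda;
  inv_epsilon : epsilon st = (4 * sigma * Lambda st)^-1;
  inv_stored_ge1 : forall r, 1 <= stored st 0 r;
  inv_weight_ge1 : forall r, 1 <= weight st 0 r;
  inv_stored : norm1 (stored st) <= m%:R * expR ((phase st)%:R - 1);
  inv_past : forall t C, (0 < t < phase st)%N -> X C (sol st t C);
  inv_current : forall C, exists2 x, X C x &
    sol st (phase st) C = served (todo st) (alpha st) C *: x;
  inv_future : forall t C, (phase st < t)%N -> sol st t C = 0;
  inv_stored_load : forall r,
    epsilon st * load (sol st) (phase st) r <= ln (stored st 0 r);
  inv_weight_load : forall r,
    epsilon st * load (sol st) (phase st).+1 r <= ln (weight st 0 r);
  inv_growth : forall x_, (forall C, X C (x_ C)) ->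
    norm1 (weight st) <= norm1 (stored st) + (3 * Lambda st)^-1 *
      \sum_C served (todo st) (alpha st) C * dotp (weight st) (x_ C);
  inv_calls : (calls st)%:R <= discarded (Lambda st) +
    n%:R * ((phase st)%:R - 1) +
    \sum_C (served (todo st) (alpha st) C == 1)%:R +
    4 * sigma * \sum_r ln (weight st 0 r)
}.

(** * Loads and the initial state *)

Lemma load0 k r : load (fun _ _ => 0) k r = 0.
Proof. by rewrite /load big1// => t _; rewrite big1// => C _; rewrite mxE. Qed.

Lemma eq_load s s' k r : (forall t C, (0 < t < k)%N -> s t C = s' t C) ->
  load s k r = load s' k r.
Proof.
move=> ss'; apply: eq_big_nat => t tk; apply: eq_bigr => C _.
by rewrite ss'.
Qed.

Lemma loadS s k r : (0 < k)%N ->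
  load s k.+1 r = load s k r + \sum_C s k C 0 r.
Proof. by move=> k0; rewrite /load big_nat_recr. Qed.

Lemma norm1_const1 : norm1 (const_mx 1 : 'rV[R]_m) = m%:R.
Proof.
rewrite /norm1 (eq_bigr (fun=> 1)) => [|r _]; last by rewrite mxE normr1.
by rewrite sumr_const card_ord.
Qed.

Lemma invariant_init :
  invariant (init_state n m sigma) /\ weight_bounded (init_state n m sigma).
Proof.
have nm : norm1 (const_mx 1 : 'rV[R]_m) = m%:R := norm1_const1.
split; last by rewrite /weight_bounded/= nm ler_peMr ?(ltW m_gt0)// ge1_expR.
have w1 r : 1 <= (const_mx 1 : 'rV[R]_m) 0 r by rewrite mxE.
split => //=.
- by rewrite enum_uniq.
- by rewrite lexx ler01.
- by move: lambda_ge1; lra.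
- by rewrite mulr1.
- by rewrite nm subrr expR0 mulr1.
- by move=> [|[]].
- move=> C; have [x Xx] := X_neq0 C; exists x => //.
  by rewrite served_enum scale0r.
- by move=> r; rewrite load0 mulr0 ln_ge0.
- by move=> r; rewrite load0 mulr0 ln_ge0.
- move=> x_ _; rewrite big1 ?mulr0 ?addr0// => C _.
  by rewrite served_enum mul0r.
- rewrite /discarded ln1 !mul0r !subrr !mulr0 !add0r.
  rewrite addr_ge0//; first exact: sumr_ge0.
  rewrite mulr_ge0//; first by move: sigma_ge1; lra.
  by apply: sumr_ge0 => r _; apply: ln_ge0.
Qed.

(** * Consequences of the invariant: growth within a phase, averages of phases *)

Lemma weight_bounded_ge st : invariant st -> lambda <= Lambda st ->
  weight_bounded st.
Proof.
move=> I lL; rewrite /weight_bounded.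
have [x [x_ Xx xE] x2] : exists2 x, minkowski_sum X x & `|x| < 3 / 2 * lambda.
  by apply: lambda_star_adherent => //; move: lambda_ge1; lra.
have /andP[L1 _] := inv_Lambda I.
have := inv_growth I Xx.
set y := weight st; set S := \sum_C _.
have y0 : nonneg_orthant y by move=> r; apply: le_trans (inv_weight_ge1 I r).
have N0 : 0 <= norm1 y by apply: sumr_ge0.
have : S <= norm1 y * (3 / 2 * Lambda st).
  apply: (@le_trans _ _ (dotp y x)).
    rewrite xE dotp_sumr; apply: ler_sum => C _.
    rewrite ler_piMl ?served_le1//; last by case/andP: (inv_alpha I).
    by apply: dotp_ge0 => //; apply: X_ge0.
  rewrite (le_trans (dotp_le_norm _ _))// ler_wpM2l//; lra.
rewrite -(ler_pM2l (_ : 0 < (3 * Lambda st)^-1)); last first.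
  by rewrite invr_gt0; lra.
(* The growth term is at most half of [norm1 y], so [norm1 y] is at most twice the stored norm;
   [expR 1 >= 2] then absorbs this factor. *)
have -> : (3 * Lambda st)^-1 * (norm1 y * (3 / 2 * Lambda st)) = norm1 y / 2.
  by field; lra.
move=> h1 h2; have h3 := inv_stored I.
rewrite -[X in expR X](subrK 1) expRD mulrA.
have := @expR_ge1Dx R 1.
have := mulr_ge0 (ltW m_gt0) (expR_ge0 ((phase st)%:R - 1 : R)).
nra.
Qed.

Lemma phases_average s k : (forall t C, (0 < t <= k)%N -> X C (s t C)) ->
  exists2 z, minkowski_sum X z &
    \sum_(1 <= t < k.+1) \sum_C s t C = k%:R *: z.
Proof.
move=> Xs.
have /choice[z zP] : forall C, exists z : 'rV[R]_m,
    X C z /\ \sum_(1 <= t < k.+1) s t C = k%:R *: z.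
  move=> C; have [z ? ?] := convex_set_sum (@X_convex C) (X_neq0 C)
    (fun t => Xs t C).
  by exists z.
exists (\sum_C z C); first by exists z => // C; case: (zP C).
by rewrite exchange_big scaler_sumr; apply: eq_bigr => C _; case: (zP C).
Qed.

(** Each scaled load is at most the logarithm of a stored weight, and a single weight is at most
    [norm1 (stored st) <= m * expR k]. Used at the end for the output and at each restart to bound
    the phase number. *)
Lemma phases_average_norm st k : invariant st -> phase st = k.+1 ->
  exists2 z, minkowski_sum X z &
    \sum_(1 <= t < k.+1) \sum_C sol st t C = k%:R *: z /\
    epsilon st * k%:R * `|z| <= ln m%:R + k%:R.
Proof.
move=> I pk.
have [|z Xz zE] := @phases_average (sol st) k.
  by move=> t C tk; apply: (inv_past I); rewrite pk ltnS.
exists z => //; split => //.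
have e0 : 0 <= epsilon st.
  have /andP[? _] := inv_Lambda I.
  by rewrite (inv_epsilon I) invr_ge0 !mulr_ge0//; move: sigma_ge1; lra.
have lm0 : 0 <= ln (m%:R : R) by rewrite ln_ge0// ler1n ltnW.
have ek0 : 0 <= epsilon st * k%:R by rewrite mulr_ge0.
rewrite -[X in X * _]ger0_norm// -normrZ.
apply: row_norm_le => [|r]; first by rewrite addr_ge0.
have -> : ((epsilon st * k%:R) *: z) 0 r =
    epsilon st * load (sol st) (phase st) r.
  rewrite -scalerA -zE mxE pk /load summxE; congr (_ * _).
  by apply: eq_bigr => t _; rewrite summxE.
rewrite ger0_norm; last first.
  rewrite mulr_ge0// /load big_nat; apply: sumr_ge0 => t tk.
  apply: sumr_ge0 => C _; apply: (X_ge0 (C := C)).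
  by apply: (inv_past I).
apply: le_trans (inv_stored_load I r) _.
rewrite -(@expRK R k%:R) -lnM ?posrE ?expR_gt0//.
have s1 := inv_stored_ge1 I r.
rewrite ler_ln ?posrE ?mulr_gt0 ?expR_gt0//; last by lra.
have := inv_stored I; rewrite pk -natr1 addrK; apply: le_trans.
rewrite (le_trans (ler_norm _))// (le_trans _ (norm_le_norm1 _))//.
exact: row_le_norm.
Qed.

(** * Preservation of the invariant *)

Lemma invariant_serve st C l : invariant st -> todo st = C :: l ->
  alpha st < 1 -> invariant (serve C st).
Proof.
move=> I tE a1; have /andP[a0 _] := inv_alpha I.
have /andP[L1 L2] := inv_Lambda I.
have L0 : 0 < Lambda st by lra.
set y := weight st; set b := f C y.
have y1 r : 1 <= y 0 r := inv_weight_ge1 I r.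
have y0 : nonneg_orthant y by move=> r; apply: le_trans (y1 r).
have [Xb _] := f_oracle C y0.
have b0 : nonneg_orthant b := X_ge0 Xb.
have [] := step_sizeP b a1 L0.
set xi := step_size _ _ _ => xi0 axi xiL xiE.
have eE := inv_epsilon I.
have s1 := sigma_ge1.
have l1 := lambda_ge1.
have s0 : 0 < sigma by lra.
have eL : 4 * sigma * (epsilon st * Lambda st) = 1.
  by rewrite eE; field; rewrite !gt_eqF.
have e0 : 0 < epsilon st by rewrite eE invr_gt0 !mulr_gt0.
have ex0 r : 0 <= epsilon st * xi * b 0 r by rewrite !mulr_ge0 // ltW.
have servedE D : served (todo (serve C st)) (alpha (serve C st)) D =
    served (todo st) (alpha st) D + (D == C)%:R * xi.
  by rewrite /= tE served_head.
have phase0 : (0 < phase st)%N by case/andP: (inv_phase I).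
have yy' r : y 0 r <= weight (serve C st) 0 r.
  by rewrite mxE ler_peMr// ge1_expR.
split => //.
- exact: inv_phase I.
- exact: inv_uniq I.
- by rewrite /= -/xi; lra.
- exact: inv_Lambda I.
- exact: inv_stored_ge1 I.
- by move=> r; apply: le_trans (yy' r).
- exact: inv_stored I.
- move=> t D /= /andP[t0 tp]; rewrite ltn_eqF//=.
  by apply: (inv_past I); rewrite t0.
- move=> D; rewrite servedE /= eqxx/=.
  have [x Xx xE] := inv_current I D.
  have [DC|DC] := eqVneq D C; last by exists x => //; rewrite mul0r addr0.
  subst D; rewrite mul1r.
  have [|z Xz zE] := @convex_set_cone R m (X C) x b
     (served (todo st) (alpha st) C) xi (@X_convex C) _ xi0 Xx Xb.
    exact: served_ge0.
  by exists z => //; rewrite xE -zE.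
- move=> t D /= pt; rewrite gtn_eqF//=; exact: (inv_future I).
- move=> r /=; rewrite (_ : load _ _ _ = load (sol st) (phase st) r).
    exact: inv_stored_load I r.
  by apply: eq_load => t D /andP[_ tp]; rewrite ltn_eqF.
- move=> r /=; rewrite mxE lnM ?posrE ?expR_gt0//; last first.
    exact: lt_le_trans (y1 r).
  rewrite expRK loadS//.
  have -> : load (fun t D => if (t == phase st) && (D == C)
      then sol st t D + xi *: b else sol st t D) (phase st) r =
      load (sol st) (phase st) r.
    by apply: eq_load => t D /andP[_ tp]; rewrite ltn_eqF.
  have -> : \sum_D (if (phase st == phase st) && (D == C)
      then sol st (phase st) D + xi *: b else sol st (phase st) D) 0 r =
      \sum_D sol st (phase st) D 0 r + xi * b 0 r.
    rewrite (bigD1 C)//= [in RHS](bigD1 C)//= !eqxx/= !mxE addrAC.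
    by congr (_ + _ + _); apply: eq_bigr => D /negPf ->; rewrite ?andbF.
  have := inv_weight_load I r; rewrite loadS// -/y -/b -/xi; lra.
- move=> x_ Xx; under eq_bigr => D _ do rewrite servedE mulrDl.
  rewrite big_split/=.
  set y' := weight (serve C st).
  have -> : \sum_D (D == C)%:R * xi * dotp y' (x_ D) = xi * dotp y' (x_ C).
    rewrite (bigD1 C)//= eqxx mul1r big1 ?addr0// => D /negPf ->.
    by rewrite !mul0r.
  have y'0 : nonneg_orthant y' by move=> r; apply: le_trans (yy' r).
  have xC := oracle_le (ltW s0) (@f_oracle C) (@X_ge0 C) y0 (Xx C).
  (* The exponential is linearised entrywise: the step size keeps the exponent at most
     [epsilon * Lambda = (4 * sigma)^-1 <= 1/4]. *)
  have step : norm1 y' <= norm1 y + 4 / 3 * epsilon st * xi * dotp y b.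
    rewrite !norm1_ge0E// /dotp mulr_sumr -big_split/=.
    apply: ler_sum => r _; rewrite mxE.
    have := @expR_le_quarter R (epsilon st * xi * b 0 r).
    have h : epsilon st * xi * b 0 r <= 4^-1.
      have br : xi * b 0 r <= Lambda st.
        apply: le_trans xiL; rewrite ler_wpM2l ?(ltW xi0)//.
        by rewrite (le_trans (ler_norm _))// row_le_norm.
      have : epsilon st * (xi * b 0 r) <= epsilon st * Lambda st 
        by rewrite ler_wpM2l ?(ltW e0).
      have : epsilon st * Lambda st <= 4^-1.
        have : 0 < epsilon st * Lambda st by rewrite mulr_gt0.
        by nra.
      rewrite mulrA; lra.
    move=> /(_ h (ex0 r)) /(ler_wpM2l (y0 r)); rewrite -/y -/b; lra.
  have mono D : dotp y (x_ D) <= dotp y' (x_ D).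
    by apply: ler_dotpl => //; apply: X_ge0.
  have g := inv_growth I Xx.
  have c0 : 0 < (3 * Lambda st)^-1 by rewrite invr_gt0; lra.
  (* The oracle guarantee costs a factor [sigma], and [4 / 3 * epsilon * sigma] is exactly
     [(3 * Lambda)^-1]. *)
  have : 4 / 3 * epsilon st * xi * dotp y b <=
      (3 * Lambda st)^-1 * (xi * dotp y' (x_ C)).
    have -> : (3 * Lambda st)^-1 = 4 / 3 * epsilon st * sigma.
      by rewrite eE; field; rewrite !gt_eqF.
    have k0 : 0 <= 4 / 3 * epsilon st * xi.
      by rewrite !mulr_ge0 ?(ltW e0) ?(ltW xi0).
    have := ler_wpM2l k0 (le_trans xC (ler_wpM2l (ltW s0) (mono C))); lra.
  have : (3 * Lambda st)^-1 *
       \sum_D served (todo st) (alpha st) D * dotp y (x_ D) <=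
     (3 * Lambda st)^-1 *
       \sum_D served (todo st) (alpha st) D * dotp y' (x_ D).
    rewrite ler_wpM2l ?(ltW c0)//; apply: ler_sum => D _.
    by rewrite ler_wpM2l// served_ge0.
  move: g step; rewrite -/y /=; lra.
- have := inv_calls I; rewrite -/y.
  have -> : \sum_D (served (todo (serve C st)) (alpha (serve C st)) D == 1)%:R
     = \sum_D (served (todo st) (alpha st) D == 1)%:R +
       (alpha st + xi == 1)%:R :> R.
    have servedC : served (todo st) (alpha st) C = alpha st.
      by rewrite /served tE inE/= eqxx.
    rewrite (bigD1 C)//= [in RHS](bigD1 C)//= -/(todo (serve C st)).
    rewrite -/(alpha (serve C st)) servedE servedC (lt_eqF a1) eqxx mul1r add0r.
    rewrite addrC; congr (_ + _); apply: eq_bigr => D /negPf DC.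
    by rewrite servedE DC mul0r addr0.
  have -> : \sum_r ln (weight (serve C st) 0 r) =
      \sum_r ln (y 0 r) + epsilon st * xi * \sum_r b 0 r.
    rewrite mulr_sumr -big_split/=; apply: eq_bigr => r _; rewrite mxE.
    by rewrite lnM ?posrE ?expR_gt0 ?expRK//; apply: lt_le_trans (y1 r).
  (* The new call is paid for by the completed customer or, when [xi * |b| = Lambda], by the
     increase of the log-weights. *)
  have : 1 <= (alpha st + xi == 1)%:R +
      4 * sigma * (epsilon st * xi * \sum_r b 0 r).
    have bs : `|b| <= \sum_r b 0 r by rewrite -norm1_ge0E// norm_le_norm1.
    case: xiE => [->|xib].
      rewrite eqxx lerDl !mulr_ge0// ?(ltW s0) ?(ltW e0) ?(ltW xi0)//.
      by rewrite (le_trans _ bs).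
    have h : epsilon st * Lambda st <= epsilon st * xi * \sum_r b 0 r.
      by rewrite -xib -mulrA !ler_wpM2l ?(ltW e0) ?(ltW xi0).
    have s4 : 0 <= 4 * sigma by lra.
    have := ler_wpM2l s4 h; rewrite eL => /le_trans; apply.
    by rewrite lerDr.
  rewrite /= -natr1; lra.
Qed.

(** The bound on [calls] is a premise because the overshooting weights have no usable bound on their
    logarithms. It is derived from the state before the last call, whence the [+ 1]. *)
Lemma invariant_restart st : invariant st -> ~ weight_bounded st ->
  (phase st <= T)%N ->
  (calls st)%:R <= discarded (Lambda st) + n%:R * (phase st)%:R +
     4 * sigma * (m%:R * (phase st)%:R) + 1 ->
  invariant (restart st) /\ weight_bounded (restart st).
Proof.
move=> I Nwb pT calls_le.
have Ll : Lambda st < lambda.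
  by rewrite ltNge; apply/negP => /(weight_bounded_ge I).
have /andP[L1 _] := inv_Lambda I.
have phase0 : (0 < phase st)%N by case/andP: (inv_phase I).
have s1 := sigma_ge1.
have l1 := lambda_ge1.
have s0 : 0 < sigma by lra.
have e0 : 0 < epsilon st by rewrite (inv_epsilon I) invr_gt0 !mulr_gt0//; lra.
have [k pk] : exists k, phase st = k.+1 by exists (phase st).-1; rewrite prednK.
have load_ge0 r : 0 <= load (sol st) (phase st) r.
  rewrite /load big_nat; apply: sumr_ge0 => t tk.
  by apply: sumr_ge0 => C _; apply: (X_ge0 (C := C)); apply: (inv_past I).
have loadE r : load (sol (restart st)) (phase st) r =
    load (sol st) (phase st) r.
  by apply: eq_load => t D /andP[_ tp]; rewrite /= ltn_eqF.
(* Halving [epsilon] only weakens the claim, as loads are nonnegative. *)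
have half r : epsilon (restart st) * load (sol (restart st)) (phase st) r <=
    ln (stored st 0 r).
  rewrite loadE /=; have := inv_stored_load I r.
  have := mulr_ge0 (ltW e0) (load_ge0 r); lra.
split; last first.
  rewrite /weight_bounded/= (le_trans (inv_stored I))//.
  by rewrite ler_pM2l// ler_expR gerBl.
split => //=.
- exact: inv_phase I.
- exact: enum_uniq.
- by rewrite lexx ler01.
- lra.
- by rewrite (inv_epsilon I); field; rewrite !gt_eqF//; lra.
- exact: inv_stored_ge1 I.
- exact: inv_stored_ge1 I.
- exact: inv_stored I.
- move=> t C /andP[t0 tp]; rewrite ltn_eqF//.
  by apply: (inv_past I); rewrite t0.
- move=> C; have [x Xx] := X_neq0 C; exists x => //.
  by rewrite eqxx served_enum scale0r.
- by move=> t C pt; rewrite gtn_eqF//; apply: (inv_future I).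
- move=> r; rewrite loadS// [X in _ + X]big1 ?addr0; first exact: half.
  by move=> C _; rewrite /= eqxx mxE.
- move=> x_ _; rewrite big1 ?mulr0 ?addr0// => C _.
  by rewrite served_enum mul0r.
- have l0 : 0 <= \sum_r ln (stored st 0 r).
    by apply: sumr_ge0 => r _; apply: ln_ge0; apply: inv_stored_ge1 I r.
  rewrite [X in _ + X + _]big1 => [|C _]; last first.
    by rewrite served_enum eq_sym oner_eq0.
  have := mulr_ge0 (ltW s0) l0; move: calls_le.
  have ln2 : 0 < ln (2 : R) by rewrite ln_gt0// ltr1n.
  (* Doubling adds one unit to [ln L / ln 2] and [Lambda] to [L - 1]. *)
  have -> : discarded (2 * Lambda st) = discarded (Lambda st) +
      (n%:R + 1 + 4 * sigma * m%:R) +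
      32 * sigma ^+ 2 * m%:R * T%:R / lambda * Lambda st.
    rewrite /discarded lnM ?posrE//; last by lra.
    by field; rewrite !gt_eqF//; lra.
  have [z Xz [_ zn]] := phases_average_norm I pk.
  have kT : k%:R <= T%:R :> R by rewrite ler_nat -ltnS -pk ltnW.
  have lm := ln_le_nphases.
  (* The average of the [k] completed phases is feasible, so its norm is at least [lambda]; a late
     restart therefore forces a large [Lambda]. *)
  have kl : k%:R * lambda <= 8 * sigma * T%:R * Lambda st.
    have : epsilon st * (k%:R * lambda) <= 2 * T%:R.
      apply: (@le_trans _ _ (ln m%:R + k%:R)); last by lra.
      apply: le_trans zn; rewrite mulrA ler_wpM2l ?mulr_ge0 ?(ltW e0)//.
      exact: lambda_star_le.
    rewrite (inv_epsilon I) mulrC ler_pdivrMr ?mulr_gt0//; last by lra.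
    lra.
  have : 4 * sigma * (m%:R * k%:R) <=
      32 * sigma ^+ 2 * m%:R * T%:R / lambda * Lambda st.
    rewrite [leRHS]mulrAC ler_pdivlMr; last by lra.
    have := ler_wpM2l (_ : 0 <= 4 * sigma * m%:R) kl.
    rewrite !mulr_ge0 ?(ltW s0) ?(ltW m_gt0)// => /(_ isT); lra.
  rewrite pk -natr1; lra.
Qed.

Lemma sum_served_eq1_le l a : \sum_C (served l a C == 1)%:R <= n%:R :> R.
Proof.
rewrite -[n in n%:R]card_ord -sumr_const ler_sum// => C _.
by rewrite lern1 leq_b1.
Qed.

Lemma invariant_step st : invariant st -> weight_bounded st ->
  invariant (step f st) /\ weight_bounded (step f st).
Proof.
move=> I wb; rewrite /step; case: ifPn => // /negbTE.
rewrite /halted ltnNge => /negbFE pT.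
have phase0 : (0 < phase st)%N by case/andP: (inv_phase I).
case tE : (todo st) => [|C l]; last case: ifPn => a1.
- split; last first.
    rewrite /weight_bounded/= (le_trans wb)// ler_pM2l// ler_expR ler_nat//.
  have w1 := inv_weight_ge1 I.
  split => //=.
  + exact: enum_uniq.
  + by rewrite lexx ler01.
  + exact: inv_Lambda I.
  + exact: inv_epsilon I.
  + by rewrite -natr1 addrK.
  + move=> t C /andP[t0]; rewrite ltnS leq_eqVlt => /predU1P[->|tp].
      by have [x Xx ->] := inv_current I C; rewrite tE served_nil scale1r.
    by apply: (inv_past I); rewrite t0.
  + move=> C; have [x Xx] := X_neq0 C; exists x => //.
    by rewrite served_enum scale0r (inv_future I).
  + by move=> t C pt; apply: (inv_future I); apply: ltnW.
  + exact: inv_weight_load I.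
  + move=> r; rewrite loadS// [X in _ + X]big1 ?addr0.
      exact: inv_weight_load I r.
    by move=> C _; rewrite (inv_future I)// mxE.
  + move=> x_ _; rewrite big1 ?mulr0 ?addr0// => C _.
    by rewrite served_enum mul0r.
  + have := inv_calls I; rewrite -[(phase st).+1%:R]natr1 addrK tE.
    (* All [n] customers are complete; their count moves into the term [n * (phase - 1)] of the new
       phase. *)
    rewrite (eq_bigr (fun=> 1)) => [|C _]; last by rewrite served_nil eqxx.
    rewrite sumr_const card_ord [X in _ -> _ <= _ + X + _]big1 => [|C _].
      by lra.
    by rewrite served_enum eq_sym oner_eq0.
- have I' := invariant_serve I tE a1.
  have -> : while_body f C st = if m%:R * expR (phase st)%:R <
      norm1 (weight (serve C st)) then restart (serve C st)
      else serve C st by [].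
  case: ifPn => h; last by split => //; rewrite /weight_bounded leNgt.
  apply: invariant_restart => //; first by rewrite /weight_bounded leNgt h.
  have := inv_calls I; rewrite /= -natr1.
  have w0 r : 0 < weight st 0 r := lt_le_trans ltr01 (inv_weight_ge1 I r).
  have := sum_ln_le w0 wb.
  rewrite -(ler_pM2l (_ : 0 < 4 * sigma)); last by move: sigma_ge1; lra.
  have := sum_served_eq1_le (todo st) (alpha st); lra.
- have a_eq1 : alpha st = 1.
    apply/le_anti; rewrite [1 <= _]leNgt a1 andbT.
    by case/andP: (inv_alpha I).
  have sE D : served (todo (next_customer st)) (alpha (next_customer st)) D =
      served (todo st) (alpha st) D.
    rewrite /= tE/= a_eq1; apply: served_behead.
    by rewrite -tE; apply: inv_uniq I.
  split => //; split => //.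
  + exact: inv_phase I.
  + by have := inv_uniq I; rewrite /= tE => /andP[].
  + by rewrite /= lexx ler01.
  + exact: inv_Lambda I.
  + exact: inv_epsilon I.
  + exact: inv_stored_ge1 I.
  + exact: inv_weight_ge1 I.
  + exact: inv_stored I.
  + exact: inv_past I.
  + by move=> D; rewrite sE; apply: inv_current I D.
  + exact: inv_future I.
  + exact: inv_stored_load I.
  + exact: inv_weight_load I.
  + move=> x_ Xx; under eq_bigr => D _ do rewrite sE.
    exact: inv_growth I x_ Xx.
  + by under eq_bigr => D _ do rewrite sE; apply: inv_calls I.
Qed.

(** * Termination *)

Lemma invariant_run k :
  invariant (run sigma f k) /\ weight_bounded (run sigma f k).
Proof.
elim: k => [|k [I wb]]; first exact: invariant_init.
by rewrite /run iterS; apply: invariant_step.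
Qed.

(** The last summand counts finished customers and drops by at most [n] on a restart or a new phase;
    the weight [n.+2] on calls and phases outweighs this. *)
Lemma progress_step st : invariant st -> ~~ halted st ->
  (calls st * n.+2 + phase st * n.+2 + (n - size (todo st)) <
   calls (step f st) * n.+2 + phase (step f st) * n.+2 +
     (n - size (todo (step f st))))%N.
Proof.
move=> I h; rewrite /step (negbTE h).
have : (size (todo st) <= n)%N.
  by rewrite -[n in (_ <= n)%N]card_ord -(card_uniqP (inv_uniq I)) max_card.
case tE : (todo st) => [|C l] /= sn; last case: ifP => a1.
- by rewrite size_enum_ord; nia.
- rewrite /while_body; case: ifP => _ /=; rewrite ?tE ?size_enum_ord/=; nia.
- by rewrite /= tE/=; nia.
Qed.

Lemma run_halts (B : nat) : (forall k, (calls (run sigma f k) <= B)%N) ->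
  exists k, halted (run sigma f k).
Proof.
move=> callsB; apply: contrapT => /forallNP nh.
have grow k : (k <= calls (run sigma f k) * n.+2 +
    phase (run sigma f k) * n.+2 + (n - size (todo (run sigma f k))))%N.
  elim: k => // k IH; rewrite /run iterS -/(run sigma f k).
  apply: leq_ltn_trans IH _; apply: progress_step; last exact/negP.
  by case: (invariant_run k).
have := grow (B * n.+2 + T.+1 * n.+2 + n).+1.
set k := _.+1; have := callsB k.
have [/inv_phase/andP[_ +] _] := invariant_run k.
set c := calls _; set p := phase _; set q := size _ => pT cB.
rewrite leqNgt ltnS leq_add ?leq_subr// leq_add// leq_mul2r.
  by rewrite cB.
by rewrite pT.
Qed.

(** * The explicit bound on oracle calls *)

Hypothesis lambda_le : lambda <= sigma * m%:R.

Lemma calls_le k : (calls (run sigma f k))%:R <=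
  300 * sigma ^+ 2 * ((n + m)%:R * ln (m%:R : R)).
Proof.
have [I wb] := invariant_run k; set st := run _ _ _ in I wb *.
have /andP[L1 L2] := inv_Lambda I.
have s1 := sigma_ge1; have l1 := lambda_ge1; have ll := lambda_le.
have s0 : 0 < sigma by lra.
have m0 := m_gt0.
have [/andP[_ pT]] := inv_phase I.
have pT' : (phase st)%:R <= T%:R + 1 :> R by rewrite natr1 ler_nat.
have Tl := nphases_lt.
(* As [m >= 2], this gives [1 <= 2 * L] for [L = ln m], so additive constants are absorbed:
   [T <= 3 * L] and [phase st <= 5 * L]. *)
have ln2 : 2^-1 <= ln (2 : R).
  have := @ln_le_subr1 R 2^-1; rewrite lnV ?posrE//; lra.
have lm : ln (2 : R) <= ln (m%:R : R) by rewrite ler_ln ?posrE// ler_nat.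
set L := ln (m%:R : R) in Tl lm *.
have w0 r : 0 < weight st 0 r := lt_le_trans ltr01 (inv_weight_ge1 I r).
have lnw : \sum_r ln (weight st 0 r) <= m%:R * (5 * L).
  by apply: le_trans (sum_ln_le w0 wb) _; rewrite ler_wpM2l ?(ltW m0)//; lra.
(* The upper bound on [lambda] enters here: it makes the number of doublings logarithmic in [m]. *)
have lnL : ln (Lambda st) <= (2 * sigma + 2) * L.
  have : ln (Lambda st) <= ln (2 * (sigma * m%:R)).
    by rewrite ler_ln ?posrE ?mulr_gt0//; lra.
  rewrite !lnM ?posrE ?mulr_gt0// -/L.
  have := ln_le_subr1 s0.
  have := ler_wpM2l (ltW s0) (_ : 1 <= 2 * L).
  rewrite (_ : 1 <= 2 * L) => [/(_ isT)|]; lra.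
set N : R := n%:R; set M : R := m%:R.
have N0 : 0 <= N by [].
have M1 : 1 <= M by rewrite ler1n ltnW.
have A0 : N + 1 + 4 * sigma * M <= 5 * sigma * (N + M) by nra.
have D1 : ln (Lambda st) / ln 2 * (N + 1 + 4 * sigma * M) <=
    (8 * sigma * L) * (5 * sigma * (N + M)).
  have lnL0 : 0 <= ln (Lambda st) by apply: ln_ge0.
  rewrite ler_pM// ?divr_ge0 ?addr_ge0 ?mulr_ge0 ?(ltW s0)//; try lra.
  rewrite ler_pdivrMr; last by lra.
  have sL : 0 <= sigma * L by rewrite mulr_ge0//; lra.
  have := ler_wpM2l sL ln2.
  have : L <= sigma * L by rewrite ler_peMl//; lra.
  lra.
have D2 : 32 * sigma ^+ 2 * M * T%:R / lambda * (Lambda st - 1) <=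
    64 * sigma ^+ 2 * M * (3 * L).
  have -> : 32 * sigma ^+ 2 * M * T%:R / lambda * (Lambda st - 1) =
      32 * sigma ^+ 2 * M * (T%:R * ((Lambda st - 1) / lambda)).
    by field; lra.
  have -> : 64 * sigma ^+ 2 * M * (3 * L) = 32 * sigma ^+ 2 * M * (3 * L * 2).
    by ring.
  have C0 : 0 <= 32 * sigma ^+ 2 * M by have := sqr_ge0 sigma; nra.
  apply: (ler_wpM2l C0).
  apply: ler_pM => //; [by apply: divr_ge0; lra | lra |].
  by rewrite ler_pdivrMr; lra.
have := inv_calls I; rewrite /discarded -/N -/M.
have := sum_served_eq1_le (todo st) (alpha st); rewrite -/N.
rewrite natrD -/N -/M.
have e1 : N * (phase st)%:R <= N * (5 * L) by rewrite ler_wpM2l//; lra.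
have e2 := ler_wpM2l (_ : 0 <= 4 * sigma) lnw.
have {}e2 := e2 (mulr_ge0 (ler0n _ 4) (ltW s0)).
have NL0 : 0 <= N * L by rewrite mulr_ge0//; lra.
have ML0 : 0 <= M * L by rewrite mulr_ge0//; lra.
have ss : 1 <= sigma ^+ 2 by rewrite expr2; nra.
have s2 : sigma <= sigma ^+ 2 by rewrite expr2; nra.
have e3 := ler_wpM2r NL0 ss.
have e4 := ler_wpM2r ML0 s2.
have e5 := ler_wpM2r ML0 ss.
rewrite -/M in e2; lra.
Qed.

End Algorithm.

Theorem theorem6 (R : realType) (sigma : R) (sigma_ge1 : 1 <= sigma) :
  exists2 K : R, 0 < K &
    forall (n m : nat) (X : 'I_n -> set 'rV[R]_m)
      (f : 'I_n -> 'rV[R]_m -> 'rV[R]_m),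
    (1 < m)%N ->
    (forall C, X C !=set0) ->
    (forall C, closed (X C)) ->
    (forall C, convex_set (X C)) ->
    (forall C, X C `<=` @nonneg_orthant R m) ->
    (forall C, is_oracle sigma (X C) (f C)) ->
    1 <= lambda_star X <= sigma * m%:R ->
    exists k : nat,
      let st := run sigma f k in
      [/\ halted st,
          minkowski_sum X (output st),
          `|output st| <= 16 * sigma * lambda_star X &
          (calls st)%:R <= K * ((n + m)%:R * ln (m%:R : R))].
Proof.
exists (300 * sigma ^+ 2).
  by rewrite mulr_gt0 ?ltr0n// exprn_gt0// (lt_le_trans ltr01 sigma_ge1).
move=> n m X f m1 X0 _ Xc Xp fo /andP[l1 ls].
have calls_le := calls_le sigma_ge1 m1 X0 Xc Xp fo l1 ls.
have [k hk] : exists k, halted (run sigma f k).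
  apply: (run_halts sigma_ge1 m1 X0 Xc Xp fo l1
    (B := Num.truncn (300 * sigma ^+ 2 * ((n + m)%:R * ln (m%:R : R))))) => k.
  rewrite Num.Theory.truncn_ge_nat ?calls_le//.
  exact: le_trans (ler0n _ _) (calls_le 0%N).
exists k => /=; set st := run _ _ _ in hk *.
have [I _] := invariant_run sigma_ge1 m1 X0 Xc Xp fo l1 k; rewrite -/st in I.
have pE : phase st = (nphases R m).+1.
  (* Halting means that the phase exceeds [T], and the invariant caps it at [T + 1]. *)
  by apply/eqP; rewrite eqn_leq; case/andP: (inv_phase I) => _ ->.
have [z Xz [zE zn]] := phases_average_norm sigma_ge1 m1 X0 Xc Xp I pE.
have T0 : 0 < (nphases R m)%:R :> R by rewrite ltr0n nphases_gt0.
have -> : output st = z.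
  by rewrite /output zE scalerA mulVf ?scale1r// gt_eqF.
split => //; last exact: calls_le.
have lT := ln_le_nphases R m1.
have /andP[L1 L2] := inv_Lambda I.
have s0 : 0 < sigma by lra.
(* Both [ln m] and the phase count are at most [T], giving [2 / epsilon]; the final factor 2 comes
   from [Lambda <= 2 * lambda]. *)
have : `|z| <= 8 * sigma * Lambda st.
  have : epsilon st * (nphases R m)%:R * `|z| <= 2 * (nphases R m)%:R by lra.
  rewrite mulrAC ler_pM2r// (inv_epsilon I) mulrC ler_pdivrMr ?mulr_gt0//; lra.
have := ler_wpM2l (ltW s0) L2; lra.
Qed.
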